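(* Let $f=m_1+\dots+m_t$ be a $k$-homogeneous $n$-variable Boolean function, with $m_1,\dots,m_t$ the distinct monomials of its ANF. Then \[|N_k(f)|=\sum_{\ell=1}^{t}(-2)^{\ell-1}\sum_{\{i_1,\dots,i_\ell\}\subseteq[t],\ |\{i_1,\dots,i_\ell\}|=\ell}\left|\bigcap_{j=1}^{\ell}N_k(m_{i_j})\right|.\]
   Context: An $n$-variable Boolean function $f\colon\mathbb{F}_2^n\to\mathbb{F}_2$ is written in algebraic normal form (ANF) as a sum of distinct monomials $\prod_{i\in I}x_i$, $I\subseteq[n]$; it is $k$-homogeneous if all these monomials have degree $k$. For a Boolean function $g$, $N_k(g)$ denotes the set of $k$-dimensional linear subspaces $U$ of $\mathbb{F}_2^n$ with $\sum_{x\in U}g(x)\neq 0$. $[t]=\{1,\dots,t\}$. *)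

(* Defs.v *)
From HB Require Import structures.
From mathcomp Require Import all_boot all_order all_algebra all_field.
Set Implicit Arguments.
Unset Strict Implicit.
Unset Printing Implicit Defensive.
Import GRing.Theory.
Local Open Scope ring_scope.

(* A vector space over a finite field has finitely many subspaces: a subspace
   is stored as a (canonical) matrix over the field. *)
HB.instance Definition _ (F : finFieldType) (vT : vectType F) :=
  CanIsCountable (@VectorInternalTheory.vs2mxK F vT).
HB.instance Definition _ (F : finFieldType) (vT : vectType F) :
    isFinite {vspace vT} :=
  CanIsFinite (@VectorInternalTheory.vs2mxK F vT).

Definition boolean_function (n : nat) := {ffun 'rV['F_2]_n -> 'F_2}.

Definition monomial (n : nat) (I : {set 'I_n}) : boolean_function n :=
  [ffun x : 'rV['F_2]_n => \prod_(i in I) x 0 i].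

(* A is the set of monomials, encoded by their sets of variables, in the
   algebraic normal form of f. *)
Definition is_anf (n : nat) (f : boolean_function n) (A : {set {set 'I_n}}) :=
  f = \sum_(I in A) monomial I.

Definition homogeneous (n k : nat) (f : boolean_function n) :=
  exists2 A : {set {set 'I_n}}, is_anf f A & {in A, forall I : {set 'I_n}, #|I| = k}.

Definition N (n k : nat) (g : boolean_function n) :
    {set {vspace 'rV['F_2]_n}} :=
  [set U : {vspace 'rV['F_2]_n} | (\dim U == k) && (\sum_(x in U) g x != 0)].

(* Main.v *)
(* For each [U], the sums over [U] of the [m_j] are elements of F_2 adding up to
   the sum of [f], so [U] lies in [N k f] exactly when it lies in an odd number
   of the sets [N k (m_j)]. The formula is inclusion-exclusion for the points
   covered an odd number of times: a point covered [s] times is counted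
   sum_(l >= 1) (-2)^(l-1) binom(s, l) = (1 - (1 - 2)^s) / 2 times. *)
Require Import Defs.
From HB Require Import structures.
From mathcomp Require Import all_boot all_order all_algebra all_field.
Set Implicit Arguments.
Unset Strict Implicit.
Unset Printing Implicit Defensive.
Import GRing.Theory.
Local Open Scope ring_scope.

Lemma sum_expN2_bin (s t : nat) : (s <= t)%N ->
  \sum_(1 <= l < t.+1) (-2) ^+ l.-1 * ('C(s, l))%:Z = (odd s)%:Z.
Proof.
(* Multiplying by -2 turns the exponent [l.-1] into [l], and the added 1 supplies the missing term
   [l = 0]: the left side becomes the binomial expansion of [(1 - 2) ^+ s]. *)
move=> le_st; apply: (@mulfI int (-2)) => //; apply: (addrI 1).
have -> : 1 + -2 * (odd s)%:Z = (1 - 2) ^+ s.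
  by rewrite -(signr_odd int s); case: (odd s).
rewrite exprDn big_distrr /= -(big_mkord xpredT
  (fun i => (1 ^+ (s - i) * (-2) ^+ i) *+ 'C(s, i) : int)).
under eq_big_nat => l /andP[l_gt0 _] do rewrite mulrA -exprS prednK //.
transitivity (\sum_(0 <= l < t.+1) (-2) ^+ l * ('C(s, l))%:Z).
  by rewrite [RHS]big_ltn // bin0 mulr1.
rewrite (big_cat_nat (n := s.+1)) //= [X in _ + X]big_nat_cond
  [X in _ + X]big1 ?addr0.
  by apply: eq_bigr => l _; rewrite expr1n mul1r -natz mulr_natr.
by move=> l /andP[/andP[lt_sl _] _]; rewrite bin_small ?mulr0.
Qed.

(** Double counting: for fixed [x], the [J] of size [l] whose intersection contains [x] are the
    [l]-subsets of [[set i | x \in A i]], so there are ['C(s, l)] of them, with [s] the cardinal of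
    that set. *)
Lemma card_odd_cover (T I : finType) (A : I -> {set T}) :
  (#|[set x | odd #|[set i | x \in A i]|]|)%:Z =
    \sum_(1 <= l < #|I|.+1) (-2) ^+ l.-1 *
      \sum_(J : {set I} | #|J| == l) (#|\bigcap_(i in J) A i|)%:Z.
Proof.
have cardE (B : {set T}) : (#|B|)%:Z = \sum_x (x \in B : nat)%:Z.
  by rewrite -sum1_card -natz natr_sum big_mkcond; apply: eq_bigr => x _; case: ifP.
under [RHS]eq_bigr => l _.
  under eq_bigr => J _ do rewrite cardE.
  rewrite exchange_big big_distrr /=; over.
rewrite exchange_big cardE; apply: eq_bigr => x _ /=; rewrite inE.
rewrite -(sum_expN2_bin (max_card _)); apply: eq_bigr => l _; congr (_ * _).
rewrite -cards_draws -sum1_card -natz natr_sum.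
rewrite big_mkcond [RHS]big_mkcond; apply: eq_bigr => J _.
suff xAE : (x \in \bigcap_(i in J) A i) = (J \subset [set i | x \in A i]).
  by rewrite inE xAE; case: (_ \subset _); case: eqP.
by apply/bigcapP/subsetP => [xA i /xA | JA i /JA]; rewrite inE.
Qed.

(** Each [a] in ['F_2] is the image of the truth value of [a != 0], so the sum is the image of a
    cardinal, nonzero in characteristic 2 exactly when odd. *)
Lemma sum_F2_neq0 (I : finType) (s : I -> 'F_2) :
  (\sum_i s i != 0) = odd #|[set i | s i != 0]|.
Proof.
have F2E (a : 'F_2) : a = (a != 0)%:R by case: a => [[|[|?]] ?] //; apply/val_inj.
rewrite -[odd _]negbK -dvdn2 (dvdn_pcharf (pchar_Fp (isT : prime 2))).
rewrite -sum1dep_card natr_sum [in RHS]big_mkcond; congr (_ != 0).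
by apply: eq_bigr => i _; rewrite [LHS]F2E; case: ifP.
Qed.

Lemma N_sum (n k : nat) (I : finType) (g : I -> boolean_function n) :
  N k (\sum_i g i) = [set U | odd #|[set i | U \in N k (g i)]|].
Proof.
apply/setP => U; rewrite !inE.
under eq_bigr => x _ do rewrite sum_ffunE.
rewrite exchange_big sum_F2_neq0.
have [dimU | dimU] := boolP (\dim U == k) => /=.
  by congr (odd #|pred_of_set _|); apply/setP => i; rewrite !inE dimU.
(* A [U] of dimension other than [k] lies in no [N k (g i)], and 0 is even. *)
rewrite (_ : [set i | _] = set0) ?cards0 //.
by apply/setP => i; rewrite !inE (negPf dimU).
Qed.

Theorem theorem4p2 (n k t : nat) (f : boolean_function n)
    (m : 'I_t -> {set 'I_n}) :
  homogeneous k f ->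
  injective m ->
  f = \sum_(j < t) monomial (m j) ->
  (#|N k f|)%:Z =
    \sum_(1 <= l < t.+1) (-2) ^+ l.-1 *
      \sum_(J : {set 'I_t} | #|J| == l)
        (#|\bigcap_(j in J) N k (monomial (m j))|)%:Z.
Proof.
by move=> _ _ ->; rewrite N_sum card_odd_cover card_ord.
Qed.
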